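(* Every upcycle with diamondicity $d\ge 1$ lifts to a De Bruijn cycle. That is, if $u$ is an upcycle for $A^n$ with diamondicity $d\ge 1$, then there is a De Bruijn cycle for $A^n$ that is a lift of $u$.
   Context: Let $A=\{0,\dots,a-1\}$, $a\ge 2$, be an alphabet and $\diamond\notin A$ a wildcard symbol (''diamond''). A partial word is a finite sequence over $A\cup\{\diamond\}$; a cyclic partial word $(u_1\cdots u_N)$ is cyclically ordered, with indices taken modulo $N$. A partial word $x$ covers a partial word $y$ of the same length if for each $i$ either $x_i=\diamond$ or $x_i=y_i$; a cyclic partial word covers a cyclic partial word of the same length if this holds for a suitable alignment (rotation). For $n\ge 1$, the window of $u$ at position $i\in\{1,\dots,N\}$ is $u_i\cdots u_{i+n-1}$. An upcycle for $A^n$ is a cyclic partial word $u=(u_1\cdots u_N)$ such that each word of $A^n$ is covered by the window at exactly one position $i\in\{1,\dots,N\}$. It is known that the diamonds of an upcycle are $n$-periodic, so all windows contain the same number $d$ of diamonds, called the diamondicity; then $u$ has length $a^{n-d}$. A De Bruijn cycle for $A^n$ is an upcycle for $A^n$ with no diamonds ($d=0$). $u^{(q)}$ denotes the cyclic concatenation of $q$ copies of $u$. If $u$ and $w$ are upcycles for $A^n$ with diamondicities $d$ and $d'$ respectively, where $d'<d$, then $w$ is a lift of $u$ (and $u$ lifts to $w$) if $w$ is covered by $u^{(a^{d-d'})}$. *)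

(* Defs.v *)
From mathcomp Require Import all_boot.
Set Implicit Arguments.
Unset Strict Implicit.
Unset Printing Implicit Defensive.

(* [None] is the wildcard symbol (diamond).  The same type is used for cyclic
   partial words, which are given by a linear representative starting at an
   arbitrary position; the notions below that concern cyclic partial words do
   not depend on this choice. *)
Definition partial_word (a : nat) : Type := seq (option 'I_a).

Definition total_word (a n : nat) (v : n.-tuple 'I_a) : partial_word a :=
  [seq Some c | c <- v].

(* [all2] is false on sequences of different lengths. *)
Definition covers (a : nat) (x y : partial_word a) : bool :=
  all2 (fun b c => (b == None) || (b == c)) x y.

Definition cyclic_covers (a : nat) (x y : partial_word a) : Prop :=
  exists k : nat, covers (rot k x) y.

(* Positions are numbered from 0.  The window may wrap around several times
   when n exceeds the length of u. *)
Definition window (a n : nat) (u : partial_word a) (i : nat) : partial_word a :=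
  mkseq (fun j => nth None u ((i + j) %% size u)) n.

Definition upcycle (a n : nat) (u : partial_word a) : Prop :=
  forall v : n.-tuple 'I_a,
    exists! i : 'I_(size u), covers (window n u i) (total_word v).

(* A relation rather than a function: that some d works is a (known) property
   of upcycles; d is then unique, as an upcycle is nonempty when a > 0. *)
Definition has_diamondicity (a n : nat) (u : partial_word a) (d : nat) : Prop :=
  forall i : 'I_(size u), count_mem None (window n u i) = d.

Definition de_bruijn_cycle (a n : nat) (w : partial_word a) : Prop :=
  upcycle n w /\ None \notin w.

Definition cyclic_power (a : nat) (u : partial_word a) (q : nat) :
    partial_word a :=
  flatten (nseq q u).

Definition is_lift (a n : nat) (w u : partial_word a) : Prop :=
  exists d d' : nat,
    [/\ upcycle n u /\ has_diamondicity n u d,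
        upcycle n w /\ has_diamondicity n w d',
        d' < d
      & cyclic_covers (cyclic_power u (a ^ (d - d'))) w].

(* Main.v *)
Require Import Defs.
From mathcomp Require Import all_boot all_fingroup.

(* Each word of [A^n] sits at a unique position of [u]; view it as an edge from
   (its position, its first n-1 letters) to (the next position, its last n-1
   letters).  As the diamonds of [u] are n-periodic, every vertex has equal in-
   and out-degree; as any two words can be completed to an infinite sequence
   covered by [u u u ...], the graph is strongly connected.  The first letters
   along an Eulerian circuit form the required De Bruijn cycle. *)

Set Implicit Arguments.
Unset Strict Implicit.
Unset Printing Implicit Defensive.

(* A successor permutation with fewest cycles has a single one: edges with the
   same target lie on the same cycle, since otherwise exchanging their
   successors would merge two cycles. *)
Lemma euler_perm (E : finType) (V : eqType) (src tgt : E -> V) (s0 : {perm E}) :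
    (forall e, src (s0 e) = tgt e) ->
    (forall x y, connect [rel e f | tgt e == src f] x y) ->
  exists s : {perm E},
    (forall e, src (s e) = tgt e) /\ (forall x y, y \in porbit s x).
Proof.
move=> s0P conn.
pose P (s : {perm E}) := [forall e, src (s e) == tgt e].
have Ps0 : P s0 by apply/forallP=> e; rewrite s0P.
case: (arg_minnP (fun s : {perm E} => #|porbits s|) Ps0) => s /forallP Ps smin.
have sP e : src (s e) = tgt e by apply/eqP.
exists s; split=> // x0 y0.
have same_tgt x y : tgt x = tgt y -> x \in porbit s y.
  move=> xy; apply/negPn/negP => xNy.
  have Pt : P (tperm x y * s)%g.
    apply/forallP=> e; rewrite permM sP.
    by case: tpermP => [->|->|//]; rewrite xy.
  have xDy : x != y by apply: contraNneq xNy => ->; apply: porbit_id.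
  have := porbits_mul_tperm s x y; rewrite xNy xDy /= addn2 addn1 => -[eq_s].
  by have := smin _ Pt; rewrite -eq_s ltnn.
(* The predecessor of [y] under [s] has target [src y], as [x] does, so both lie on one cycle, which
   also contains [y]. *)
have step x y : tgt x = src y -> porbit s x = porbit s y.
  move=> xy; have yE : y = s ((s^-1)%g y) by rewrite permKV.
  have : x \in porbit s ((s^-1)%g y) by apply: same_tgt; rewrite xy {1}yE sP.
  by rewrite -eq_porbit_mem => /eqP->; rewrite {2}yE -(porbit_perm s 1) expg1.
have /connectP[p pP ->] := conn x0 y0.
suff -> : porbit s x0 = porbit s (last x0 p) by apply: porbit_id.
by elim: p x0 pP => //= y p IHp x /andP[/eqP/step-> /IHp].
Qed.

(** * Covering, diamonds and word counts *)

Definition letter a (u : partial_word a) t := nth None u (t %% size u).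

Definition fits a (p : option 'I_a) (c : 'I_a) := (p == None) || (p == Some c).

Lemma fits_odflt a p (c : 'I_a) : fits p (odflt c p).
Proof. by case: p => [b|]; rewrite /fits ?eqxx. Qed.

Lemma covers_windowP a n (u : partial_word a) i (v : n.-tuple 'I_a) :
  reflect (forall j : 'I_n, fits (letter u (i + j)) (tnth v j))
          (covers (window n u i) (total_word v)).
Proof.
rewrite /covers all2E size_mkseq size_map size_tuple eqxx /=.
apply: (iffP (all_nthP (None, None))) => [cov j | fit j].
  have := cov j; rewrite size_zip size_mkseq size_map size_tuple minnn.
  move=> /(_ (ltn_ord j)); rewrite nth_zip ?size_mkseq ?size_map ?size_tuple //=.
  by rewrite nth_mkseq // (nth_map (tnth_default v j)) ?size_tuple // -tnth_nth.
rewrite size_zip size_mkseq size_map size_tuple minnn => jn.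
have := fit (Ordinal jn); set j' := Ordinal jn.
rewrite nth_zip ?size_mkseq ?size_map ?size_tuple //=.
by rewrite nth_mkseq // (nth_map (tnth_default v j')) ?size_tuple // -tnth_nth.
Qed.

Lemma window_mod a n (u : partial_word a) i :
  window n u (i %% size u) = window n u i.
Proof. by apply: eq_mkseq => j; rewrite modnDml. Qed.

Lemma count_window a n (u : partial_word a) i :
  count_mem None (window n u i) = \sum_(j < n) (letter u (i + j) == None).
Proof.
rewrite /window /mkseq count_map -sum1_count big_mkcond /=.
rewrite -(big_mkord xpredT (fun j => nat_of_bool (letter u (i + j) == None))).
by rewrite /index_iota subn0; apply: eq_bigr => j _; rewrite /letter; case: eqP.
Qed.

(** The windows at [t] and [t + 1] have equally many diamonds and share all entries except the first
    of one and the last of the other. *)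
Lemma diamond_periodic a n d (u : partial_word a) t :
    0 < size u -> has_diamondicity n u d ->
  (letter u (t + n) == None) = (letter u t == None).
Proof.
move=> N0 ud; pose b t := nat_of_bool (letter u t == None).
have udt i : \sum_(j < n) b (i + j) = d.
  by rewrite -(ud (Ordinal (ltn_pmod i N0))) window_mod count_window.
have: b t + \sum_(j < n) b (t.+1 + j) = \sum_(j < n) b (t + j) + b (t + n).
  rewrite -[RHS](big_ord_recr n (fun j : 'I_n.+1 => b (t + j))) big_ord_recl addn0.
  by congr (_ + _); apply: eq_bigr => j _; rewrite addSnnS.
rewrite !udt addnC => /addnI; rewrite /b.
by case: (letter u t == None); case: (letter u (t + n) == None).
Qed.

Lemma card_fits a (p : option 'I_a) : #|fits p| = a ^ (p == None).
Proof.
case: p => [b|] /=; last by rewrite expn1 -[RHS]card_ord; apply: eq_card.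
by rewrite expn0 -(card1 b); apply: eq_card => c; rewrite !inE /fits /= eq_sym.
Qed.

(** Each diamond leaves [a] choices and each letter one, independently, so the covered words
    correspond to a product family of functions. *)
Lemma card_covered a n (u : partial_word a) i :
  #|[pred v : n.-tuple 'I_a | covers (window n u i) (total_word v)]|
    = a ^ count_mem None (window n u i).
Proof.
pose F (j : 'I_n) : pred 'I_a := fits (letter u (i + j)).
pose h (f : {ffun 'I_n -> 'I_a}) := [tuple f j | j < n].
have hI : injective h.
  by move=> f g fg; apply/ffunP => j; have := congr1 (fun v => tnth v j) fg; rewrite !tnth_mktuple.
rewrite -(eq_card (A := [pred v | v \in image h (family F)])); last first.
  move=> v; rewrite !inE; apply/imageP/covers_windowP => [[f /familyP fF -> j]|fit].
    by rewrite tnth_mktuple; apply: fF.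
  exists [ffun j => tnth v j]; first by apply/familyP => j; rewrite ffunE; apply: fit.
  by apply: eq_from_tnth => j; rewrite tnth_mktuple ffunE.
rewrite (card_image hI) card_family foldrE big_map big_enum count_window expn_sum.
by apply: eq_bigr => j _; apply: card_fits.
Qed.

Lemma upcycle_pos a n (u : partial_word a) : upcycle n u ->
  exists pos : n.-tuple 'I_a -> 'I_(size u),
    forall v i, covers (window n u i) (total_word v) = (i %% size u == pos v).
Proof.
move=> /fin_all_exists[pos posP]; exists pos => v i; have [cov uniq] := posP v.
have N0 : 0 < size u by apply: leq_ltn_trans (ltn_ord (pos v)).
rewrite -window_mod; apply/idP/eqP => [|-> //].
by move=> /(uniq (Ordinal (ltn_pmod i N0))) ->.
Qed.

(** Sorting all words by position leaves [a ^ d] of them, those covered by the window, at each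
    position. *)
Lemma size_upcycle a n d (u : partial_word a) :
  upcycle n u -> has_diamondicity n u d -> size u * a ^ d = a ^ n.
Proof.
move=> /upcycle_pos[pos posP] ud.
rewrite -[X in X ^ n](card_ord a) -card_tuple -sum1_card.
rewrite (partition_big pos xpredT) //= -[X in X * _](card_ord (size u)) -sum_nat_const.
apply: eq_bigr => i _; rewrite -(ud i) -card_covered sum1_card.
by apply: eq_card => v; rewrite !inE posP modn_small //= eq_sym.
Qed.

Definition word_at a n (f : nat -> 'I_a) t : n.-tuple 'I_a := [tuple f (t + j) | j < n].

Lemma nth_word_at a n (f : nat -> 'I_a) t c j :
  j < n -> nth c (word_at n f t) j = f (t + j).
Proof. by move=> jn; rewrite -[j]/(val (Ordinal jn)) -tnth_nth tnth_mktuple. Qed.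

Lemma covers_word_at a n (u : partial_word a) f t :
    (forall k, fits (letter u k) (f k)) ->
  covers (window n u t) (total_word (word_at n f t)).
Proof. by move=> uf; apply/covers_windowP => j; rewrite tnth_mktuple. Qed.

(** * The graph of words, its connectivity and its successor permutation *)

Section Graph.

Variables (a' m d : nat).
Let a := a'.+1.
Let n := m.+1.
Variables (u : partial_word a) (pos : n.-tuple 'I_a -> 'I_(size u)).
Hypothesis posP : forall v i, covers (window n u i) (total_word v) = (i %% size u == pos v).
Hypothesis ud : has_diamondicity n u d.

(** Vertices stay plain pairs, since [euler_perm] asks only for an [eqType] of vertices. *)
Definition src v : nat * seq 'I_a := (val (pos v), take m v).
Definition tgt v : nat * seq 'I_a := ((pos v).+1 %% size u, behead v).

Lemma pos_fits v (j : 'I_n) : fits (letter u (pos v + j)) (tnth v j).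
Proof.
have : covers (window n u (pos v)) (total_word v) by rewrite posP modn_small.
by move/covers_windowP; apply.
Qed.

Lemma connect_src_tgt x y : connect [rel e f | tgt e == src f] x y.
Proof.
(* [T] is congruent to [pos y] modulo [N], and [n.+1] periods suffice to pass the end of [x],
   because [pos x < N] and [n <= n * N]. *)
pose N := size u; pose T := pos y + n.+1 * N.
have N0 : 0 < N by apply: leq_ltn_trans (ltn_ord (pos x)).
have leT : pos x + n <= T.
  apply: leq_trans (leq_addl _ _); rewrite mulSn leq_add //; first exact: ltnW.
  exact: leq_pmulr.
(* The sequence spells [x] from [pos x] and [y] from [T]; elsewhere it copies [u], with [ord0] for
   diamonds. Its successive words form a walk from [x] to [y]. *)
pose f t := if pos x <= t < pos x + n then nth ord0 x (t - pos x)
            else if T <= t < T + n then nth ord0 y (t - T)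
            else odflt ord0 (letter u t).
have uf t : fits (letter u t) (f t).
  rewrite /f; case: ifP => [/andP[le lt]|_].
    have lt' : t - pos x < n by rewrite ltn_subLR.
    by have := pos_fits x (Ordinal lt'); rewrite (tnth_nth ord0) /= subnKC.
  case: ifP => [/andP[le lt]|_]; last exact: fits_odflt.
  have lt' : t - T < n by rewrite ltn_subLR.
  have := pos_fits y (Ordinal lt'); rewrite (tnth_nth ord0) /= /letter.
  by rewrite -(modnMDl n.+1) -/N addnA [_ * _ + _]addnC -/T subnKC.
have fx : word_at n f (pos x) = x.
  apply: eq_from_tnth => j; rewrite tnth_mktuple /f leq_addr ltn_add2l ltn_ord /=.
  by rewrite addKn -tnth_nth.
have fy : word_at n f T = y.
  apply: eq_from_tnth => j; rewrite tnth_mktuple /f.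
  rewrite leq_addr ltn_add2l ltn_ord /= addKn -tnth_nth.
  by rewrite [_ < pos x + n]ltnNge (leq_trans leT (leq_addr _ _)) andbF.
have posf t : val (pos (word_at n f t)) = t %% N.
  by apply/esym/eqP; rewrite -posP covers_word_at.
rewrite -fx -fy -(subnKC (leq_trans (leq_addr _ _) leT)).
elim: (T - pos x) => [|k IHk]; first by rewrite addn0.
apply: connect_trans IHk (connect1 _); rewrite /= /tgt /src !posf addnS.
apply/eqP; congr (_, _); first by rewrite -addn1 modnDml addn1.
apply: (@eq_from_nth _ ord0) => [|i].
  by rewrite size_behead size_takel size_tuple.
rewrite size_behead size_tuple /= => im.
by rewrite nth_behead nth_take // !nth_word_at ?addSnnS // leqW.
Qed.

(* When the next letter of [u] is a diamond, so is the one about to leave the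
   window, by periodicity; keeping the first letter of [v] then makes this
   injective. *)
Definition shift (v : n.-tuple 'I_a) : n.-tuple 'I_a :=
  [tuple of rcons (behead_tuple v) (odflt (thead v) (letter u (pos v + n)))].

Lemma src_shift v : src (shift v) = tgt v.
Proof.
rewrite /src /tgt; congr (_, _); last first.
  by rewrite /= -cats1 take_size_cat // size_behead size_tuple.
apply/esym/eqP; rewrite -posP; apply/covers_windowP => j.
rewrite (tnth_nth ord0) /= nth_rcons size_behead size_tuple /= nth_behead.
case: ltnP => [jm|mj].
  have jn : j.+1 < n by [].
  by have := pos_fits v (Ordinal jn); rewrite (tnth_nth ord0) /= addSnnS.
have -> : val j = m by apply/eqP; rewrite eqn_leq mj -ltnS ltn_ord.
by rewrite eqxx addSnnS fits_odflt.
Qed.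

Lemma shift_inj : injective shift.
Proof.
move=> v w eq_s; have N0 : 0 < size u by apply: leq_ltn_trans (ltn_ord (pos v)).
have eq_t : tgt v = tgt w by rewrite -!src_shift eq_s.
have eq_b : behead v = behead w := congr1 snd eq_t.
have eq_p : pos v = pos w.
  have /eqP : (pos v).+1 = (pos w).+1 %[mod size u] := congr1 fst eq_t.
  rewrite -(addn1 (pos v)) -(addn1 (pos w)) eqn_modDr !modn_small //.
  by move=> /eqP/ord_inj.
have /= := congr1 (fun x : n.-tuple _ => last ord0 x) eq_s.
rewrite !last_rcons eq_p => eq_l.
have per := diamond_periodic (pos w) N0 ud.
suff eq_h : thead v = thead w.
  by apply: val_inj; rewrite /= (tuple_eta v) (tuple_eta w) /= eq_h eq_b.
have := pos_fits v ord0; have := pos_fits w ord0; rewrite !addn0 eq_p.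
rewrite /fits -per -!/(thead _).
(* If this letter is a diamond, the last letters of the shifts are the first letters of [v] and [w].
   If not, periodicity makes [u] carry a letter at the common position, which fixes both first
   letters. *)
case: (letter u (pos w + n)) per eq_l => [b|] //= per _.
by case: (letter u (pos w)) per => //= c _ /eqP[<-] /eqP[].
Qed.

Lemma eulerian_circuit : exists s : {perm n.-tuple 'I_a},
  (forall v, src (s v) = tgt v) /\ (forall v w, w \in porbit s v).
Proof.
apply: (euler_perm (s0 := perm shift_inj)); last exact: connect_src_tgt.
by move=> v; rewrite permE src_shift.
Qed.

End Graph.

(** * Reading the De Bruijn cycle off the circuit *)

Theorem corollary6p5 (a n d : nat) (u : partial_word a) :
  2 <= a -> 1 <= n ->
  upcycle n u -> has_diamondicity n u d -> 1 <= d ->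
  exists w : partial_word a, de_bruijn_cycle n w /\ is_lift n w u.
Proof.
case: a u => // a' u _; case: n => // m _ uup ud d0.
set a := a'.+1; set n := m.+1.
have uN := size_upcycle uup ud.
have [pos posP] := upcycle_pos uup.
have [s [sP s1]] := eulerian_circuit posP ud.
pose f t := odflt ord0 (letter u t).
(* Starting at a word of position 0 puts [g k] at position [k %% size u], so that the final covering
   holds without rotation. *)
pose v0 := word_at n f 0.
pose g k := iter k s v0; pose W := a ^ n.
have N0 : 0 < size u by apply: leq_ltn_trans (ltn_ord (pos v0)).
have W0 : 0 < W by rewrite expn_gt0.
have gpos k : val (pos (g k)) = k %% size u.
  elim: k => [|k IHk].
    apply/esym/eqP; rewrite -posP; apply: covers_word_at => t; exact: fits_odflt.
  rewrite [LHS](congr1 fst (sP (g k))) [LHS]/= IHk.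
  by rewrite -(addn1 (k %% _)) modnDml addn1.
have gS k : behead (g k) = take m (g k.+1) by rewrite [RHS](congr1 snd (sP (g k))).
(* Successive words overlap in [m] letters, so [g k] is spelled by the first letters of [g k], ...,
   [g (k + m)]. *)
have g_nth j k : j < n -> nth ord0 (g k) j = thead (g (k + j)).
  elim: j k => [|j IHj] k jn; first by rewrite addn0 /thead (tnth_nth ord0).
  by rewrite -nth_behead gS nth_take // IHj ?addSnnS // ltnW.
have orbW : #|porbit s v0| = W.
  rewrite -[RHS](_ : #|{: n.-tuple 'I_a}| = W); last by rewrite card_tuple card_ord.
  by apply: eq_card => v; rewrite s1.
(* The orbit of [v0] has [W] elements, so [W] steps along it return to [v0]. *)
have gW k : g (k %% W) = g k.
  rewrite {2}(divn_eq k W) addnC /g iterD; congr iter.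
  elim: (k %/ W) => // q IHq; rewrite mulSn iterD -IHq -orbW; exact/esym/iter_porbit.
have g_surj v : exists2 k, k < W & g k = v.
  have := s1 v0 v; rewrite porbit_traject orbW => /trajectP[k kW ->].
  by exists k.
pose w : partial_word a := mkseq (fun k => Some (thead (g k))) W.
have sw : size w = W by rewrite size_mkseq.
have wl t : letter w t = Some (thead (g t)).
  by rewrite /letter sw nth_mkseq ?ltn_pmod // gW.
(* The window of [w] at [k] spells exactly [g k]; it remains to see that [g] is a bijection from the
   numbers below [W] to the words. *)
have w_cov k v : covers (window n w k) (total_word v) = (g k == v).
  apply/covers_windowP/eqP => [fit|<- j].
    apply: eq_from_tnth => j; have := fit j; rewrite wl (tnth_nth ord0 (g k)) g_nth //.
    by rewrite /fits /= => /eqP[].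
  by rewrite wl (tnth_nth ord0) g_nth // /fits eqxx orbT.
have g_inj : {in gtn W &, injective g}.
  move=> i j iW jW /eqP; have := uniq_traject_porbit s v0; rewrite orbW.
  move=> /(uniqP v0); rewrite size_traject => inj /eqP gij; apply: inj => //.
  by rewrite !nth_traject.
have w_up : upcycle n w.
  move=> v; have [k kW gk] := g_surj v.
  have kw : k < size w by rewrite sw.
  exists (Ordinal kw); split=> [|i]; first by rewrite w_cov /= gk.
  rewrite w_cov -gk => /eqP gi; apply: val_inj => /=.
  by apply: g_inj; rewrite ?inE // -sw.
have wD : None \notin w by apply/mapP => -[].
have w_d0 : has_diamondicity n w 0.
  move=> i; apply/count_memPn/negP => /mapP[j _ /esym].
  by rewrite -/(letter w (i + j)) wl.
exists w; split=> //; exists d, 0; split=> //; exists 0; rewrite rot0 subn0.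
have nthq q t : t < q * size u -> nth None (cyclic_power u q) t = letter u t.
  elim: q t => // q IHq t; rewrite mulSn /= nth_cat /letter => tq.
  case: ltnP => [tN|Nt]; first by rewrite modn_small.
  by rewrite IHq ?ltn_subLR // /letter -{2}(subnK Nt) modnDr.
have sq : size (cyclic_power u (a ^ d)) = W.
  by rewrite /cyclic_power size_flatten /shape map_nseq sumn_nseq uN.
rewrite /covers all2E sq sw eqxx; apply/(all_nthP (None, None)) => t.
rewrite size_zip sq sw minnn => tW.
rewrite nth_zip ?sq ?sw //= nthq; last by rewrite mulnC uN.
(* The first letter of [g t] fits [u] at [pos (g t)], which is [t] modulo the length of [u]. *)
rewrite nth_mkseq //; have := pos_fits posP (g t) ord0.
by rewrite addn0 gpos /letter modn_mod.
Qed.
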